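(* For each $s\in\mathbb{S}$, the shearlet-type wavelet system $$\Psi_s(\varphi_1,\psi_1)=\{\varphi_{j_0,s,m,p},\ \psi_{j,s,m,p}: j\ge j_0,\ m\in\mathbb{Z}^2,\ p\ge0\}$$ is an orthonormal basis for $L^2(\mathbb{R}^2)$.
   Context: Fourier transform: $\hat f(\xi)=\int f(x)e^{-2\pi i\langle x,\xi\rangle}dx$. Generators: fix $\rho\in(0,\frac{2}{13})$, $\alpha\ge\frac6\rho+1$, $\beta>\alpha+1$. Let $\varphi_1,\psi_1\in L^2(\mathbb{R})$ be compactly supported with $\inf_{\xi\in[-1/2,1/2]}|\hat\varphi_1(\xi)|>0$ and, up to multiplicative constants and for $\ell=0,1$, $$\Bigl|\bigl(\tfrac{d}{d\xi}\bigr)^\ell\hat\psi_1(\xi)\Bigr|\lesssim\frac{\min\{1,|\xi|^\alpha\}}{(1+|\xi|)^\beta},\qquad \Bigl|\bigl(\tfrac{d}{d\xi}\bigr)^\ell\hat\varphi_1(\xi)\Bigr|\lesssim\frac1{(1+|\xi|)^\beta},$$ and such that $\{\varphi_1(\cdot-m):m\in\mathbb{Z}\}\cup\{2^{j/2}\psi_1(2^j\cdot-m):j\ge0,m\in\mathbb{Z}\}$ is an orthonormal basis of $L^2(\mathbb{R})$. Matrices: $A_j=\mathrm{diag}(2^j,2^{\lfloor j/2\rfloor})$, $S_s=\begin{pmatrix}1&s\\0&1\end{pmatrix}$ for $s\in\mathbb{R}$, $D_p=\mathrm{diag}(1,2^{-\max\{p-1,0\}})$ for integers $p\ge0$. Functions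 on $\mathbb{R}^2$: $\psi^0(x)=\psi_1(x_1)\varphi_1(x_2)$, $\varphi^0(x)=\varphi_1(x_1)\varphi_1(x_2)$, and for $p>0$, $\psi^p(x)=2^{(p-1)/2}\psi_1(x_1)\psi_1(2^{p-1}x_2)$, $\varphi^p(x)=2^{(p-1)/2}\varphi_1(x_1)\psi_1(2^{p-1}x_2)$. Shear parameters: $\mathbb{S}=\{0\}\cup\{q/2^i:i\ge0\text{ integer},\ q\text{ odd integer},\ |q|\le2^i\}$. For $s\in\mathbb{S}$, $j_0=j_0(s)$ denotes the smallest nonnegative integer such that $s=q_0/2^{\lceil j_0/2\rceil}$ for some integer $q_0$. Shearlet-type wavelets: $\varphi_{j,s,m,p}=|\det A_j|^{1/2}\varphi^p(A_jS_s\cdot-D_pm)$ and $\psi_{j,s,m,p}=|\det A_j|^{1/2}\psi^p(A_jS_s\cdot-D_pm)$ for $m\in\mathbb{Z}^2$, $p\ge0$. *)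

(* Defs.v *)
From mathcomp Require Import all_boot all_order all_algebra.
From mathcomp Require Import all_classical all_reals all_analysis.
From mathcomp Require Import complex.

Set Implicit Arguments.
Unset Strict Implicit.
Unset Printing Implicit Defensive.

Import Order.TTheory GRing.Theory Num.Theory.
Import numFieldNormedType.Exports.
Import Normc.

Local Open Scope classical_set_scope.
Local Open Scope ring_scope.
Local Open Scope complex_scope.

Section ComplexL2.
Context d (T : measurableType d) (R : realType).
Context (mu : {measure set T -> \bar R}).
Implicit Types f g : T -> R[i].

Definition cintegral f : R[i] :=
  (\int[mu]_x complex.Re (f x)) +i* (\int[mu]_x complex.Im (f x)).

Definition cmeasurable f : Prop :=
  measurable_fun [set: T] (fun x => complex.Re (f x)) /\
  measurable_fun [set: T] (fun x => complex.Im (f x)).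

Definition L2norm f : \bar R := Lnorm mu 2%:E (fun x => (normc (f x))%:E).

Definition L2 f : Prop := cmeasurable f /\ (L2norm f < +oo)%E.

Definition L2inner f g : R[i] := cintegral (fun x => f x * conjc (g x)).

(* Elements of L^2 are represented by measurable functions; L2norm and L2inner
   depend only on their a.e. classes.  The system is the family e restricted to the
   indices in D: distinct indices of D must give orthogonal elements.  The last
   clause says that the finite linear combinations are dense in L^2. *)
Definition orthonormal_basis (I : eqType) (D : set I) (e : I -> T -> R[i]) :
    Prop :=
  [/\ forall i, D i -> L2 (e i),
      forall i k, D i -> D k -> L2inner (e i) (e k) = (i == k)%:R &
      forall f, L2 f -> forall eps : R, 0 < eps ->
        exists (r : seq I) (c : I -> R[i]),
          (forall i, i \in r -> D i) /\
          (L2norm (fun x => (f x - \sum_(i <- r) c i * e i x)%R) < eps%:E)%E].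

End ComplexL2.

Section Fourier.
Context (R : realType).
Implicit Types f : R -> R[i].

Definition leb1 : {measure set (measurableTypeR R) -> \bar R} :=
  @lebesgue_measure R.

Definition leb2 :
    {measure set (measurableTypeR R * measurableTypeR R)%type -> \bar R} :=
  (@lebesgue_measure R \x @lebesgue_measure R)%E.

(* The factor is exp(-2 pi i x xi) = cos(2 pi x xi) - i sin(2 pi x xi).  The
   integral formula is only meant for integrable f, such as compactly supported
   elements of L^2. *)
Definition fourier f (xi : R) : R[i] :=
  cintegral leb1
    (fun x => f x * (cos (2 * pi * (x * xi)) -i* sin (2 * pi * (x * xi)))).

Definition cderivable f (x : R) : Prop :=
  derivable (fun t => complex.Re (f t)) x 1 /\
  derivable (fun t => complex.Im (f t)) x 1.

Definition cderive f (x : R) : R[i] :=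
  derive1 (fun t => complex.Re (f t)) x +i*
  derive1 (fun t => complex.Im (f t)) x.

(* An L^2 class is compactly supported when it vanishes a.e. off a bounded
   set. *)
Definition compactly_supported f : Prop :=
  exists M : R, {ae leb1, forall x : R, M < `|x| -> f x = 0}.

(* |(d/dxi)^l f| <= C w for l = 0, 1, with an unspecified constant C. *)
Definition C1_bounded_by f (w : R -> R) : Prop :=
  (forall xi, cderivable f xi) /\
  forall l : nat, (l <= 1)%N ->
    exists C : R, forall xi : R, normc (iter l cderive f xi) <= C * w xi.

End Fourier.

Section Shearlets.
Context (R : realType) (phi1 psi1 : R -> R[i]).
Implicit Types (s : R) (m : int * int) (p : nat).

(* inl m indexes phi1(. - m); inr (j, m) indexes 2^(j/2) psi1(2^j . - m). *)
Definition wavelet_system (i : int + nat * int) : R -> R[i] :=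
  match i with
  | inl m => fun x => phi1 (x - m%:~R)
  | inr (j, m) => fun x => (2 `^ (j%:R / 2))%:C * psi1 (2 ^+ j * x - m%:~R)
  end.

Definition mx2 (a b c d : R) : 'M[R]_2 :=
  \matrix_(i < 2, k < 2) nth 0 (nth [::] [:: [:: a; b]; [:: c; d]] i) k.

Definition A_mx (j : nat) : 'M[R]_2 := mx2 (2 ^+ j) 0 0 (2 ^+ j./2).
Definition S_mx s : 'M[R]_2 := mx2 1 s 0 1.
Definition D_mx p : 'M[R]_2 := mx2 1 0 0 (2 ^- p.-1).

(* The plane is R * R, which carries the product Lebesgue measure; a matrix
   acts on it as on column vectors. *)
Definition mxact (M : 'M[R]_2) (x : R * R) : R * R :=
  let y := M *m \col_(i < 2) [:: x.1; x.2]`_i in (y 0 0, y 1 0).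

Definition psi_p p (x : R * R) : R[i] :=
  match p with
  | 0 => psi1 x.1 * phi1 x.2
  | q.+1 => (2 `^ (q%:R / 2))%:C * psi1 x.1 * psi1 (2 ^+ q * x.2)
  end.

Definition phi_p p (x : R * R) : R[i] :=
  match p with
  | 0 => phi1 x.1 * phi1 x.2
  | q.+1 => (2 `^ (q%:R / 2))%:C * phi1 x.1 * psi1 (2 ^+ q * x.2)
  end.

Definition shear_set : set R :=
  [set s | s = 0 \/
    exists (i : nat) (q : int),
      [/\ odd `|q|%N, `|q| <= 2 ^+ i & s = q%:~R / 2 ^+ i]].

(* uphalf j is the ceiling of j/2. *)
Definition is_level s (j : nat) : Prop :=
  exists q : int, s = q%:~R / 2 ^+ uphalf j.

Lemma exists_level s : shear_set s -> exists j, `[< is_level s j >].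
Proof.
case=> [->|[i [q [_ _ ->]]]].
  by exists 0%N; apply/asboolP; exists 0; rewrite mul0r.
by exists i.*2; apply/asboolP; exists q; rewrite uphalf_double.
Qed.

Definition j0 s (hs : shear_set s) : nat := ex_minn (exists_level hs).

Definition shear_atom (g : R * R -> R[i]) (j : nat) s m p (x : R * R) : R[i] :=
  (Num.sqrt `|\det (A_mx j)|)%:C *
  g (mxact (A_mx j *m S_mx s) x - mxact (D_mx p) (m.1%:~R, m.2%:~R)).

Definition phi_jsmp j s m p := shear_atom (phi_p p) j s m p.
Definition psi_jsmp j s m p := shear_atom (psi_p p) j s m p.

(* inl (m, p) indexes phi_{j0,s,m,p}; inr (j, m, p) indexes psi_{j,s,m,p}. *)
Definition shearlet_index : eqType :=
  ((int * int) * nat + nat * (int * int) * nat)%type.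

Definition shearlet_indices s (hs : shear_set s) : set shearlet_index :=
  [set i | match i with
           | inl _ => True
           | inr (j, _, _) => (j0 hs <= j)%N
           end].

Definition shearlet_system s (hs : shear_set s) (i : shearlet_index) :
    R * R -> R[i] :=
  match i with
  | inl (m, p) => phi_jsmp (j0 hs) s m p
  | inr (j, m, p) => psi_jsmp j s m p
  end.

End Shearlets.

(* Main.v *)
Require Import Defs.
From mathcomp Require Import all_boot all_order all_algebra.
From mathcomp Require Import all_classical all_reals all_analysis.
From mathcomp Require Import measurable_realfun complex ring lra.
Import Order.TTheory GRing.Theory Num.Theory.
Import numFieldNormedType.Exports.
Import Normc.

Local Open Scope classical_set_scope.
Local Open Scope ring_scope.
Local Open Scope complex_scope.

Set Implicit Arguments.
Unset Strict Implicit.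
Unset Printing Implicit Defensive.

(** Put y = S_s x.  Up to the shear x |-> S_s x, every shearlet is a product
    f(y_1) g(y_2).  The functions f that occur are the generator phi_1 at scale
    2 ^ j0 and psi_1 at the scales 2 ^ j, j >= j0: this is the wavelet basis
    dilated by 2 ^ j0.  For a fixed f at scale 2 ^ j, the index p runs through
    phi_1 (p = 0) and all scales of psi_1 (p > 0), so the functions g form the
    wavelet basis dilated by 2 ^ floor(j / 2).  Dilations are unitary
    (orthonormal_basis_image with leb1_affine), so both families are orthonormal
    bases of L2(R).

    If (a_i) is an orthonormal basis and, for each i, (b_ik)_k is another one,
    then the functions a_i(y_1) b_ik(y_2) form an orthonormal basis of the plane
    (tensor_orthonormal_basis).  Orthonormality is Fubini.  For completeness,
    the closed span contains every a_i(y_1) v(y_2), because (b_ik)_k is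
    complete, hence every u(y_1) v(y_2), because (a_i) is complete, hence the
    indicators of rectangles, and these are total in L2 of a product of
    sigma-finite measures (rectangles_dense): a Dynkin argument gives the
    indicators of all sets of finite measure, and simple functions give the
    rest.

    The shear preserves planar Lebesgue measure (leb2_shear), since it
    translates horizontal lines, so composing with it again gives an orthonormal
    basis; a bijection of indices (orthonormal_basis_reindex, shearlet_systemE)
    identifies this basis with the shearlet system. *)

(** * Square-integrable complex functions *)

Section ComplexModulus.
Context (R : realType).
Implicit Types z w : R[i].

(** The squared modulus, kept in R: it is polynomial in the real and imaginary
    parts, so measurability, multiplicativity and the parallelogram bound below
    need no square root. *)
Definition abs2 z : R := complex.Re z ^+ 2 + complex.Im z ^+ 2.

Lemma ReD z w : complex.Re (z + w) = complex.Re z + complex.Re w.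
Proof. by case: z w => [? ?] [? ?]. Qed.

Lemma ImD z w : complex.Im (z + w) = complex.Im z + complex.Im w.
Proof. by case: z w => [? ?] [? ?]. Qed.

Lemma ReM z w : complex.Re (z * w) =
  complex.Re z * complex.Re w - complex.Im z * complex.Im w.
Proof. by case: z w => [? ?] [? ?]. Qed.

Lemma ImM z w : complex.Im (z * w) =
  complex.Re z * complex.Im w + complex.Im z * complex.Re w.
Proof. by case: z w => [? ?] [? ?]. Qed.

Lemma abs2_ge0 z : 0 <= abs2 z.
Proof. by rewrite addr_ge0 ?sqr_ge0. Qed.

Lemma normc_sqr z : normc z ^+ 2 = abs2 z.
Proof. by case: z => a b; rewrite /= sqr_sqrtr // addr_ge0 ?sqr_ge0. Qed.

Lemma abs2M z w : abs2 (z * w) = abs2 z * abs2 w.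
Proof. by case: z w => [a b] [c d]; rewrite /abs2 /=; ring. Qed.

Lemma abs2_real (r : R) : abs2 r%:C = r ^+ 2.
Proof. by rewrite /abs2 /= expr0n addr0. Qed.

Lemma abs2D_le z w : abs2 (z + w) <= 2 * abs2 z + 2 * abs2 w.
Proof.
case: z w => [a b] [c d]; rewrite /abs2 /=.
have h1 := sqr_ge0 (a - c); have h2 := sqr_ge0 (b - d); nra.
Qed.

(** This bound and the next one stand in for the Cauchy-Schwarz inequality: only
    the integrability of a product of two L2 functions is needed. *)
Lemma Re_mulJ_le z w : `|complex.Re (z * conjc w)| <= abs2 z + abs2 w.
Proof.
case: z w => [a b] [c d]; rewrite /abs2 /= ler_norml.
have h1 := sqr_ge0 (a - c); have h2 := sqr_ge0 (b - d).
have h3 := sqr_ge0 (a + c); have h4 := sqr_ge0 (b + d).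
by apply/andP; split; nra.
Qed.

Lemma Im_mulJ_le z w : `|complex.Im (z * conjc w)| <= abs2 z + abs2 w.
Proof.
case: z w => [a b] [c d]; rewrite /abs2 /= ler_norml.
have h1 := sqr_ge0 (a - d); have h2 := sqr_ge0 (b - c).
have h3 := sqr_ge0 (a + d); have h4 := sqr_ge0 (b + c).
by apply/andP; split; nra.
Qed.

End ComplexModulus.

Section ComplexMeasurable.
Context d (T : measurableType d) (R : realType).
Implicit Types (f g : T -> R[i]) (u : T -> R).

Lemma cmeasurable_cst (c : R[i]) : cmeasurable (fun _ : T => c).
Proof. by split; exact: measurable_cst. Qed.

Lemma cmeasurable_real u :
  measurable_fun setT u -> cmeasurable (fun x => (u x)%:C).
Proof. by move=> mu; split => //=; exact: measurable_cst. Qed.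

Lemma cmeasurableD f g : cmeasurable f -> cmeasurable g ->
  cmeasurable (fun x => f x + g x).
Proof.
move=> [mf1 mf2] [mg1 mg2]; split.
- under eq_fun do rewrite ReD; exact: measurable_funD.
- under eq_fun do rewrite ImD; exact: measurable_funD.
Qed.

Lemma cmeasurableM f g : cmeasurable f -> cmeasurable g ->
  cmeasurable (fun x => f x * g x).
Proof.
move=> [mf1 mf2] [mg1 mg2]; split.
- under eq_fun do rewrite ReM.
  by apply: measurable_funB; apply: measurable_funM.
- under eq_fun do rewrite ImM.
  by apply: measurable_funD; apply: measurable_funM.
Qed.

Lemma cmeasurable_conj f : cmeasurable f -> cmeasurable (fun x => conjc (f x)).
Proof.
move=> [mf1 mf2]; split.
- by rewrite (_ : (fun x => _) = fun x => complex.Re (f x))//;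
    apply/funext => x; case: (f x).
- rewrite (_ : (fun x => _) = fun x => - complex.Im (f x)).
    exact: measurable_funN.
  by apply/funext => x; case: (f x).
Qed.

Lemma cmeasurableB f g : cmeasurable f -> cmeasurable g ->
  cmeasurable (fun x => f x - g x).
Proof.
move=> mf mg; under eq_fun do rewrite -(mulN1r (g _)).
by apply: cmeasurableD => //; apply: cmeasurableM => //; exact: cmeasurable_cst.
Qed.

Lemma measurable_abs2 f :
  cmeasurable f -> measurable_fun setT (fun x => abs2 (f x)).
Proof.
by move=> [mf1 mf2]; apply: measurable_funD; apply: measurable_funX.
Qed.

Lemma measurable_abs2E f :
  cmeasurable f -> measurable_fun setT (fun x => (abs2 (f x))%:E).
Proof. by move=> mf; apply/measurable_EFinP; exact: measurable_abs2. Qed.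

End ComplexMeasurable.

Lemma cmeasurable_comp d1 d2 (T1 : measurableType d1) (T2 : measurableType d2)
    (R : realType) (h : T1 -> T2) (f : T2 -> R[i]) :
  measurable_fun setT h -> cmeasurable f -> cmeasurable (f \o h).
Proof.
move=> mh [mf1 mf2]; split.
- by apply: (measurableT_comp mf1 mh).
- by apply: (measurableT_comp mf2 mh).
Qed.

Section L2.
Context d (T : measurableType d) (R : realType).
Context (mu : {measure set T -> \bar R}).
Implicit Types (f g : T -> R[i]) (u : T -> R) (c : R[i]).

(** The squared L2 norm.  It is additive in the measure and factors over
    products, which makes it more convenient than the norm itself. *)
Definition L2sq f : \bar R := (\int[mu]_x (abs2 (f x))%:E)%E.

Lemma L2sq_ge0 f : (0 <= L2sq f)%E.
Proof. by apply: integral_ge0 => x _; rewrite lee_fin abs2_ge0. Qed.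

Lemma L2norm_sqr f : (L2norm mu f `^ 2 = L2sq f)%E.
Proof.
rewrite /L2norm poweR_Lnorm ?pnatr_eq0//; apply: eq_integral => x _.
by rewrite /= powR_mulrn// -normc_sqr real_normK // num_real.
Qed.

Lemma L2norm_lt f (eps : R) : 0 < eps ->
  (L2norm mu f < eps%:E)%E = (L2sq f < (eps ^+ 2)%:E)%E.
Proof.
move=> e0; rewrite -L2norm_sqr.
have : (0 <= L2norm mu f)%E by exact: Lnorm_ge0.
case: (L2norm mu f) => [r| |]; last by [].
- rewrite lee_fin => r0.
  by rewrite poweR_EFin !lte_fin powR_mulrn // ltr_pXn2r // nnegrE // ltW.
- by rewrite poweRyr ?pnatr_eq0 // !ltNge !leey.
Qed.

Lemma L2norm_lty f : (L2norm mu f < +oo)%E = (L2sq f < +oo)%E.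
Proof.
rewrite -L2norm_sqr.
have : (0 <= L2norm mu f)%E by exact: Lnorm_ge0.
case: (L2norm mu f) => [r| |]; last by [].
- by rewrite poweR_EFin !ltry.
- by rewrite poweRyr ?pnatr_eq0.
Qed.

Lemma L2P f : L2 mu f <-> cmeasurable f /\ (L2sq f < +oo)%E.
Proof. by rewrite /L2 L2norm_lty. Qed.

Lemma L2_measurable f : L2 mu f -> cmeasurable f.
Proof. by case. Qed.

Lemma L2sq_lty f : L2 mu f -> (L2sq f < +oo)%E.
Proof. by case/L2P. Qed.

Lemma L2sqD_le f g : cmeasurable f -> cmeasurable g ->
  (L2sq (fun x => f x + g x)%R <= 2%:E * L2sq f + 2%:E * L2sq g)%E.
Proof.
move=> mf mg; rewrite /L2sq -!ge0_integralZl //; first last.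
- by move=> x _; rewrite lee_fin abs2_ge0.
- exact: measurable_abs2E.
- by move=> x _; rewrite lee_fin abs2_ge0.
- exact: measurable_abs2E.
rewrite -ge0_integralD //; first last.
- by apply: measurable_funeM; exact: measurable_abs2E.
- by move=> x _; rewrite -EFinM lee_fin mulr_ge0 // abs2_ge0.
- by apply: measurable_funeM; exact: measurable_abs2E.
- by move=> x _; rewrite -EFinM lee_fin mulr_ge0 // abs2_ge0.
apply: ge0_le_integral => //.
- by move=> x _; rewrite lee_fin abs2_ge0.
- by apply: measurable_abs2E; exact: cmeasurableD.
- by apply: emeasurable_funD; apply: measurable_funeM; exact: measurable_abs2E.
- by move=> x _; rewrite -!EFinM -EFinD lee_fin abs2D_le.
Qed.

Lemma L2sqZ c f : cmeasurable f ->
  L2sq (fun x => c * f x) = ((abs2 c)%:E * L2sq f)%E.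
Proof.
move=> mf; rewrite /L2sq -ge0_integralZl_EFin ?abs2_ge0 //.
- by apply: eq_integral => x _; rewrite abs2M.
- by move=> x _; rewrite lee_fin abs2_ge0.
- exact: measurable_abs2E.
Qed.

Lemma L2_0 : L2 mu (fun _ => 0).
Proof.
apply/L2P; split; first exact: cmeasurable_cst.
rewrite /L2sq; under eq_integral do rewrite /abs2 expr0n addr0.
by rewrite integral0 ltry.
Qed.

Lemma L2_linear c f g : L2 mu f -> L2 mu g -> L2 mu (fun x => c * f x + g x).
Proof.
move=> /L2P[mf sf] /L2P[mg sg]; apply/L2P.
have mcf : cmeasurable (fun x => c * f x).
  by apply: cmeasurableM => //; exact: cmeasurable_cst.
split; first exact: cmeasurableD.
apply: le_lt_trans (L2sqD_le mcf mg) _; rewrite L2sqZ //.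
apply: lte_add_pinfty; apply: lte_mul_pinfty => //.
by apply: lte_mul_pinfty => //; rewrite lee_fin abs2_ge0.
Qed.

End L2.

(** * Linear spans and their closures in L2 *)

Section SpanClosure.
Context d (T : measurableType d) (R : realType).
Context (mu : {measure set T -> \bar R}).
Implicit Types (f g : T -> R[i]) (V W : set (T -> R[i])).

Definition linear_set V : Prop :=
  V (fun _ => 0) /\ forall c f g, V f -> V g -> V (fun x => c * f x + g x).

Definition span (I : eqType) (D : set I) (e : I -> T -> R[i]) :
    set (T -> R[i]) :=
  [set g | exists (r : seq I) (c : I -> R[i]),
     (forall i, i \in r -> D i) /\ g = fun x => \sum_(i <- r) c i * e i x].

Definition L2closure V : set (T -> R[i]) :=
  [set f | L2 mu f /\ forall eps : R, 0 < eps ->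
     exists2 g, V g & (L2sq mu (fun x => f x - g x)%R < eps%:E)%E].

Lemma linear_setZ V c f : linear_set V -> V f -> V (fun x => c * f x).
Proof.
move=> [V0 VL] Vf; rewrite (_ : (fun x => _) = fun x => c * f x + 0).
  exact: VL.
by apply/funext => x; rewrite addr0.
Qed.

Lemma linear_setD V f g : linear_set V -> V f -> V g -> V (fun x => f x + g x).
Proof.
move=> [_ VL] Vf Vg; rewrite (_ : (fun x => _) = fun x => 1 * f x + g x).
  exact: VL.
by apply/funext => x; rewrite mul1r.
Qed.

Lemma linear_setB V f g : linear_set V -> V f -> V g -> V (fun x => f x - g x).
Proof.
move=> [_ VL] Vf Vg; rewrite (_ : (fun x => _) = fun x => -1 * g x + f x).
  exact: VL.
by apply/funext => x; rewrite mulN1r addrC.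
Qed.

Lemma linear_set_sum V (I : eqType) (r : seq I) (F : I -> T -> R[i]) :
  linear_set V -> (forall i, i \in r -> V (F i)) ->
  V (fun x => \sum_(i <- r) F i x).
Proof.
move=> VL; elim: r => [|i r IH] VF.
  rewrite (_ : (fun x => _) = fun=> 0); first by case: VL.
  by apply/funext => x; rewrite big_nil.
rewrite (_ : (fun x => _) = fun x => F i x + \sum_(j <- r) F j x); last first.
  by apply/funext => x; rewrite big_cons.
apply: linear_setD => //; first by apply: VF; rewrite mem_head.
by apply: IH => j jr; apply: VF; rewrite inE jr orbT.
Qed.

Lemma sum_mulrn_count (I : eqType) (M : nmodType) (U r : seq I) (F : I -> M) :
  uniq U -> {subset r <= U} ->
  \sum_(i <- U) F i *+ count_mem i r = \sum_(i <- r) F i.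
Proof.
move=> uU; elim: r => [|a r IH] rU.
  by rewrite big_nil big1_seq.
rewrite big_cons -IH; last by move=> i ir; apply: rU; rewrite inE ir orbT.
under eq_bigr do rewrite /= mulrnDr.
rewrite big_split /=; congr (_ + _).
rewrite (bigD1_seq a) ?rU ?mem_head //= eqxx mulr1n big1 ?addr0 //.
move=> i /negbTE ia.
by rewrite eq_sym ia.
Qed.

(** The coefficients of a linear combination are indexed by the basis and not
    by positions in the list, so two combinations are merged over a common
    duplicate-free list, with multiplicities moved into the coefficients. *)
Lemma span_linear (I : eqType) (D : set I) (e : I -> T -> R[i]) :
  linear_set (span D e).
Proof.
split.
  by exists [::], (fun=> 0); split => //; apply/funext => x; rewrite big_nil.
move=> k _ _ [r1 [c1 [D1 ->]]] [r2 [c2 [D2 ->]]].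
exists (undup (r1 ++ r2)),
  (fun i => k * c1 i *+ count_mem i r1 + c2 i *+ count_mem i r2); split.
  by move=> i; rewrite mem_undup mem_cat => /orP[/D1|/D2].
apply/funext => x.
have uU := undup_uniq (r1 ++ r2).
have s1 : {subset r1 <= undup (r1 ++ r2)}.
  by move=> i ir; rewrite mem_undup mem_cat ir.
have s2 : {subset r2 <= undup (r1 ++ r2)}.
  by move=> i ir; rewrite mem_undup mem_cat ir orbT.
rewrite -(sum_mulrn_count _ uU s1) -(sum_mulrn_count _ uU s2).
rewrite mulr_sumr -big_split /=.
apply: eq_bigr => i _.
by rewrite mulrDl !mulrnAl mulrnAr mulrA.
Qed.

Lemma span_mem (I : eqType) (D : set I) (e : I -> T -> R[i]) i :
  D i -> span D e (e i).
Proof.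
move=> Di; exists [:: i], (fun=> 1); split.
  by move=> j; rewrite inE => /eqP ->.
by apply/funext => x; rewrite big_seq1 mul1r.
Qed.

Lemma span_sub (I : eqType) (D : set I) (e : I -> T -> R[i]) V :
  linear_set V -> (forall i, D i -> V (e i)) -> span D e `<=` V.
Proof.
move=> VL Ve _ [r [c [Dr ->]]].
by apply: linear_set_sum => // i /Dr Di; apply: linear_setZ => //; exact: Ve.
Qed.

Lemma L2_linear_set : linear_set (L2 mu).
Proof. by split; [exact: L2_0 | exact: L2_linear]. Qed.

Lemma sub_L2closure V : V `<=` L2 mu -> V `<=` L2closure V.
Proof.
move=> VL2 f Vf; split; first exact: VL2.
move=> eps e0; exists f => //.
rewrite /L2sq; under eq_integral do rewrite subrr /abs2 expr0n addr0.
by rewrite integral0.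
Qed.

Lemma L2sqD_lt f g (eps : R) : cmeasurable f -> cmeasurable g ->
  (L2sq mu f < (eps / 4)%:E)%E -> (L2sq mu g < (eps / 4)%:E)%E ->
  (L2sq mu (fun x => f x + g x)%R < eps%:E)%E.
Proof.
move=> mf mg sf sg; apply: le_lt_trans (L2sqD_le _ mf mg) _.
rewrite (_ : eps%:E = 2%:E * (eps / 4)%:E + 2%:E * (eps / 4)%:E)%E; last first.
  by rewrite -!EFinM -EFinD; congr EFin; lra.
by apply: lteD; rewrite lte_pmul2l.
Qed.

Lemma L2closure_linear V :
  V `<=` L2 mu -> linear_set V -> linear_set (L2closure V).
Proof.
move=> VL2 VL; split; first by apply: sub_L2closure => //; case: VL.
move=> c f g [Lf fV] [Lg gV]; split; first exact: L2_linear.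
move=> eps e0; have e40 : 0 < eps / 4 by rewrite divr_gt0.
have c10 : 0 < abs2 c + 1 by rewrite ltr_wpDl ?abs2_ge0.
(* The added 1 covers the case c = 0. *)
have [|f' Vf' ff'] := fV (eps / 4 / (abs2 c + 1)); first by rewrite divr_gt0.
have [g' Vg' gg'] := gV _ e40.
exists (fun x => c * f' x + g' x); first by case: VL => _; apply.
have mff' : cmeasurable (fun x => f x - f' x).
  exact: cmeasurableB (L2_measurable Lf) (L2_measurable (VL2 _ Vf')).
rewrite (_ : (fun x => _) =
    fun x => c * (f x - f' x) + (g x - g' x)); last first.
  by apply/funext => x; rewrite mulrBr; ring.
apply: L2sqD_lt => //.
- by apply: cmeasurableM => //; exact: cmeasurable_cst.
- exact: cmeasurableB (L2_measurable Lg) (L2_measurable (VL2 _ Vg')).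
rewrite L2sqZ //; have [c0|c0] := eqVneq (abs2 c) 0.
  by rewrite c0 mul0e lte_fin.
apply: (@le_lt_trans _ _ ((abs2 c + 1)%:E * L2sq mu (fun x => f x - f' x)%R)%E).
  by apply: lee_pmul => //; rewrite ?lee_fin ?abs2_ge0 ?L2sq_ge0 ?lerDl.
by rewrite muleC -lte_pdivlMr.
Qed.

Lemma L2closure_idem V : V `<=` L2 mu ->
  L2closure (L2closure V) `<=` L2closure V.
Proof.
move=> VL2 f [Lf fV]; split=> // eps e0.
have e40 : 0 < eps / 4 by rewrite divr_gt0.
have [g [Lg gV] fg] := fV _ e40; have [h Vh gh] := gV _ e40.
exists h => //.
rewrite (_ : (fun x => _) = fun x => (f x - g x) + (g x - h x)); last first.
  by apply/funext => x; ring.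
apply: L2sqD_lt => //.
- exact: cmeasurableB (L2_measurable Lf) (L2_measurable Lg).
- exact: cmeasurableB (L2_measurable Lg) (L2_measurable (VL2 _ Vh)).
Qed.

Lemma orthonormal_basisP (I : eqType) (D : set I) (e : I -> T -> R[i]) :
  orthonormal_basis mu D e <->
  [/\ forall i, D i -> L2 mu (e i),
      forall i k, D i -> D k -> L2inner mu (e i) (e k) = (i == k)%:R &
      L2 mu `<=` L2closure (span D e)].
Proof.
split=> -[eL2 eO eT]; split=> // f Lf; first split=> //.
- move=> eps e0; have se0 : 0 < Num.sqrt eps by rewrite sqrtr_gt0.
  have [r [c [Dr fr]]] := eT f Lf _ se0.
  exists (fun x => \sum_(i <- r) c i * e i x); first by exists r, c.
  by move: fr; rewrite L2norm_lt // sqr_sqrtr // ltW.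
- move=> eps e0; have [_ /(_ (eps ^+ 2))[|_ [r [c [Dr ->]]] fg]] := eT f Lf.
    by rewrite exprn_gt0.
  by exists r, c; split => //; rewrite L2norm_lt.
Qed.

(** Dominated convergence for nonnegative functions, in the form in which it is
    used to put limits into a closed set. *)
Lemma L2closure_dominated V (u_ : nat -> T -> R) (u : T -> R) :
  (forall n, measurable_fun setT (u_ n)) -> measurable_fun setT u ->
  (forall n x, 0 <= u_ n x <= u x) ->
  (forall x, u_ n x @[n --> \oo] --> u x) ->
  (L2sq mu (fun x => (u x)%:C) < +oo)%E ->
  (forall n, V (fun x => (u_ n x)%:C)) ->
  L2closure V (fun x => (u x)%:C).
Proof.
move=> mu_ mu' u_u u_cvg su Vu.
have Lu : L2 mu (fun x => (u x)%:C).
  by apply/L2P; split => //; exact: cmeasurable_real.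
split=> // eps e0.
pose w n x := ((u x - u_ n x) ^+ 2)%:E.
have mw n : measurable_fun setT (w n).
  by apply/measurable_EFinP/measurable_funX/measurable_funB.
have iu : mu.-integrable setT (fun x => (u x ^+ 2)%:E).
  apply/integrableP; split; first exact/measurable_EFinP/measurable_funX.
  apply: le_lt_trans su; rewrite le_eqVlt; apply/orP; left; apply/eqP.
  by apply: eq_integral => x _; rewrite abs2_real gee0_abs // lee_fin sqr_ge0.
have [||_ _] := dominated_convergence measurableT mw (measurable_cst 0%E) _ iu.
- apply: aeW => x _; apply/cvg_EFin; first by apply: nearW.
  have u0 : u x - u_ n x @[n --> \oo] --> (0 : R).
    by rewrite -(subrr (u x)); apply: cvgB => //; exact: cvg_cst.
  rewrite -(mulr0 (0 : R)) [X in X @ _](_ : _ =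
    fun n => (u x - u_ n x) * (u x - u_ n x)); first exact: cvgM.
  by apply/funext => n; rewrite /w /= expr2.
- apply: aeW => x n _; rewrite gee0_abs ?lee_fin ?sqr_ge0 //.
  have /andP[u0 uu] := u_u n x.
  by rewrite ler_pXn2r ?nnegrE ?subr_ge0 ?(le_trans u0) // lerBlDr lerDl.
rewrite integral0 => /(_ [set y : \bar R | y < eps%:E]%E)[].
  by apply: open_ereal_lt'; rewrite lte_fin.
move=> n _ /(_ n (leqnn n)) /= wn.
exists (fun x => (u_ n x)%:C) => //; apply: le_lt_trans wn.
rewrite le_eqVlt; apply/orP; left; apply/eqP.
by apply: eq_integral => x _; rewrite /w -abs2_real rmorphB.
Qed.

End SpanClosure.

(** * Density of indicator functions *)

Section IndicatorDensity.
Import HBNNSimple.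
Context d (T : measurableType d) (R : realType).
Context (mu : {measure set T -> \bar R}) (V : set (T -> R[i])).
Hypothesis V_linear : linear_set V.
Hypothesis V_closed : L2closure mu V `<=` V.

Let L2real (u : T -> R) (f : T -> R[i]) :
  measurable_fun setT u -> (forall x, u x ^+ 2 <= abs2 (f x)) -> L2 mu f ->
  (L2sq mu (fun x => (u x)%:C) < +oo)%E.
Proof.
move=> mu' uf /L2P[mf]; apply: le_lt_trans; apply: ge0_le_integral => //.
- by move=> x _; rewrite lee_fin abs2_ge0.
- by apply: measurable_abs2E; exact: cmeasurable_real.
- exact: measurable_abs2E.
- by move=> x _; rewrite lee_fin abs2_real.
Qed.

(** Simple functions increase to u and are dominated by it, and their nonzero
    level sets have finite measure because u is square integrable. *)
Lemma indicators_dense_ge0 (u : T -> R) :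
  (forall A, measurable A -> (mu A < +oo)%E -> V (fun x => (\1_A x)%:C)) ->
  measurable_fun setT u -> (forall x, 0 <= u x) ->
  (L2sq mu (fun x => (u x)%:C) < +oo)%E -> V (fun x => (u x)%:C).
Proof.
move=> V1 mu' u0 su; apply: V_closed.
have mEu : measurable_fun setT (EFin \o u) by exact/measurable_EFinP.
pose u_ := nnsfun_approx measurableT mEu.
have u_le n x : u_ n x <= u x.
  rewrite /u_ nnsfun_approxE -lee_fin.
  by apply: le_approx => // y _; rewrite lee_fin.
have mu_ n : measurable_fun setT (u_ n) by exact: measurable_funP.
apply: (@L2closure_dominated _ _ _ _ _ (fun n => u_ n : T -> R)) => //.
- by move=> n x; rewrite u_le andbT; exact: fun_ge0.
- move=> x.
  have : (u_ n x)%:E @[n --> \oo] --> (u x)%:E.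
    by apply: (cvg_nnsfun_approx measurableT mEu) => // y _; rewrite lee_fin.
  by move/fine_cvg.
move=> n; rewrite (_ : (fun x => _) = fun x =>
    \sum_(y <- finmap.enum_fset (fset_set (range (u_ n))))
      (y * \1_(u_ n @^-1` [set y]) x)%:C).
  apply: linear_set_sum => // y _.
  rewrite (_ : (fun x => _) = fun x => y%:C * (\1_(u_ n @^-1` [set y]) x)%:C).
    have [->|y0] := eqVneq y 0.
      rewrite (_ : (fun x => _) = fun=> 0); first by case: V_linear.
      by apply/funext => x; rewrite mul0r.
    have mA : measurable (u_ n @^-1` [set y]) by exact: measurable_funPTI.
    apply: linear_setZ => //; apply: V1 => //.
    (* Chebyshev: y ^ 2 times the measure of the level set is at most the
       squared norm of u. *)
    have y20 : 0 < y ^+ 2 by rewrite exprn_even_gt0.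
    have cheb : ((y ^+ 2)%:E * mu (u_ n @^-1` [set y]) <=
        L2sq mu (fun x => (u x)%:C))%E.
      rewrite -[X in (_ * mu X)%E]setIT -integral_indic //.
      rewrite -ge0_integralZl_EFin ?(ltW y20) //; last first.
        exact/measurable_EFinP/measurable_indic.
      apply: ge0_le_integral => //.
      + by move=> x _; rewrite -EFinM lee_fin mulr_ge0 // ltW.
      + apply: measurable_funeM; exact/measurable_EFinP/measurable_indic.
      + by apply: measurable_abs2E; exact: cmeasurable_real.
      move=> x _; rewrite -EFinM lee_fin abs2_real indicE.
      case: (boolP (x \in _)) => [/[!inE] /= yx|_]; last first.
        by rewrite mulr0 sqr_ge0.
      have y_ge0 : 0 <= y by rewrite -yx; exact: fun_ge0.
      by rewrite mulr1 ler_pXn2r ?nnegrE // -yx.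
    move: (le_lt_trans cheb su).
    case: (mu _) (measure_ge0 mu (u_ n @^-1` [set y])) => [r _ _|_|//].
      by rewrite ltry.
    by rewrite gt0_muley.
  by apply/funext => x; rewrite rmorphM.
apply/funext => x; by rewrite fimfunE fsbig_finite ?rmorph_sum //=.
Qed.

Lemma indicators_dense :
  (forall A, measurable A -> (mu A < +oo)%E -> V (fun x => (\1_A x)%:C)) ->
  L2 mu `<=` V.
Proof.
move=> V1 f Lf; have [mf1 mf2] := L2_measurable Lf.
have Vmax (u : T -> R) : measurable_fun setT u ->
    (forall x, u x ^+ 2 <= abs2 (f x)) -> V (fun x => (Num.max (u x) 0)%:C).
  move=> mu' uf.
  have mm : measurable_fun setT (fun x => Num.max (u x) 0).
    by apply: measurable_maxr => //; exact: measurable_cst.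
  apply: indicators_dense_ge0 => //.
  - by move=> x; rewrite le_max lexx orbT.
  apply: (L2real mm _ Lf) => x; apply: le_trans (uf x).
  by case: (lerP (u x) 0) => _; rewrite ?expr0n ?sqr_ge0.
have Vreal (u : T -> R) : measurable_fun setT u ->
    (forall x, u x ^+ 2 <= abs2 (f x)) -> V (fun x => (u x)%:C).
  move=> mu' uf; rewrite (_ : (fun x => _) =
      fun x => (Num.max (u x) 0)%:C - (Num.max (- u x) 0)%:C).
    apply: linear_setB => //; apply: Vmax => //; first exact: measurable_funN.
    by move=> x; rewrite sqrrN.
  apply/funext => x; rewrite -rmorphB; congr (_ %:C).
  case: (lerP (u x) 0); case: (lerP (- u x) 0); lra.
rewrite (_ : f = fun x => 'i%C * (complex.Im (f x))%:C + (complex.Re (f x))%:C).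
  apply: linear_setD => //; first apply: linear_setZ => //;
    apply: Vreal => // x.
  - by rewrite lerDr sqr_ge0.
  - by rewrite lerDl sqr_ge0.
by apply/funext => x; rewrite addrC -complexE.
Qed.

End IndicatorDensity.

Section ProductDensity.
Context d1 d2 (T1 : measurableType d1) (T2 : measurableType d2) (R : realType).
Context (m1 : {sigma_finite_measure set T1 -> \bar R}).
Context (m2 : {sigma_finite_measure set T2 -> \bar R}).
Context (V : set (T1 * T2 -> R[i])).
Hypothesis V_linear : linear_set V.
Hypothesis V_closed : L2closure (m1 \x m2)%E V `<=` V.

Let cind (A : set (T1 * T2)) : T1 * T2 -> R[i] := fun x => (\1_A x)%:C.

Let L2sq_cind A : measurable A -> L2sq (m1 \x m2)%E (cind A) = (m1 \x m2)%E A.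
Proof.
move=> mA; rewrite -[in RHS](setIT A) -integral_indic //.
apply: eq_integral => x _; rewrite abs2_real indicE.
by case: (x \in A); rewrite ?expr1n ?expr0n.
Qed.

Let cindX (A : set T1) (B : set T2) :
  cind (A `*` B) = fun x => (\1_A x.1)%:C * (\1_B x.2)%:C.
Proof.
apply/funext => x; rewrite /cind -rmorphM; congr (_ %:C).
by rewrite !indicE in_setX; case: (_ \in _); rewrite ?mul1r ?mul0r.
Qed.

Let cind_limit (A_ : nat -> set (T1 * T2)) (A : set (T1 * T2)) :
  (forall n, measurable (A_ n)) -> measurable A ->
  (forall n, A_ n `<=` A) ->
  (forall x, A x -> \forall n \near \oo, A_ n x) ->
  ((m1 \x m2)%E A < +oo)%E ->
  (forall n, V (cind (A_ n))) -> V (cind A).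
Proof.
move=> mA_ mA A_A A_cvg fA VA; apply: V_closed.
apply: (@L2closure_dominated _ _ _ _ _ (fun n => \1_(A_ n) : _ -> R)) => //.
- move=> n x; rewrite !indicE ler0n /= ler_nat.
  have [xA|//] := boolP (x \in A_ n).
  by rewrite (mem_set (A_A n x (set_mem xA))).
- move=> x; have [xA|xA] := pselect (A x).
    apply: cvg_near_cst; near=> n.
    have xn : A_ n x by near: n; exact: A_cvg.
    by rewrite !indicE !mem_set.
  apply: cvg_near_cst; apply: nearW => n.
  by rewrite !indicE !memNset // => /A_A.
- by have := L2sq_cind mA; rewrite /cind => ->.
Unshelve. all: by end_near. Qed.

(** The sets whose trace on a fixed rectangle of finite measure has its
    indicator in V form a Dynkin system containing the rectangles; a set of
    finite measure is then exhausted by its traces on an increasing sequence of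
    such rectangles. *)
Lemma rectangles_dense :
  (forall A B, measurable A -> measurable B ->
     (m1 A < +oo)%E -> (m2 B < +oo)%E ->
     V (fun x => (\1_A x.1)%:C * (\1_B x.2)%:C)) ->
  L2 (m1 \x m2)%E `<=` V.
Proof.
move=> VX; apply: indicators_dense => // A mA fA.
have /sigma_finiteP[F [TF ndF Foo]] := sigma_finiteT m1.
have /sigma_finiteP[G [TG ndG Goo]] := sigma_finiteT m2.
have mQ n : measurable (F n `*` G n).
  by have [? _] := Foo n; have [? _] := Goo n; exact: measurableX.
have fQ n : ((m1 \x m2)%E (F n `*` G n) < +oo)%E.
  have [? ?] := Foo n; have [? ?] := Goo n.
  by rewrite product_measure1E// lte_mul_pinfty// ge0_fin_numE.
have fIQ n B : measurable B -> ((m1 \x m2)%E (B `&` (F n `*` G n)) < +oo)%E.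
  move=> mB; apply: le_lt_trans (fQ n); apply: le_measure; rewrite ?inE //.
  exact: measurableI.
have VQ n B : measurable B -> V (cind (B `&` (F n `*` G n))).
  have [mF fF] := Foo n; have [mG fG] := Goo n.
  rewrite measurable_prod_measurableType; move: B; apply: dynkin_induction.
  - by rewrite measurable_prod_measurableType.
  - move=> _ _ [A1 mA1 [A2 mA2 <-]] [B1 mB1 [B2 mB2 <-]].
    rewrite -setXI; exists (A1 `&` B1); first exact: measurableI.
    by exists (A2 `&` B2) => //; exact: measurableI.
  - by rewrite setTI cindX; exact: VX.
  - move=> _ [A1 mA1 [A2 mA2 <-]].
    rewrite -setXI cindX.
    apply: VX; [exact: measurableI | exact: measurableI | |].
    + apply: le_lt_trans fF; apply: le_measure; rewrite ?inE //.
      exact: measurableI.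
    + apply: le_lt_trans fG; apply: le_measure; rewrite ?inE //.
      exact: measurableI.
  - move=> S mS VS.
    rewrite (_ : cind _ = fun x =>
      cind (F n `*` G n) x - cind (S `&` (F n `*` G n)) x).
      by apply: linear_setB => //; rewrite cindX; exact: VX.
    apply/funext => x; rewrite /cind -rmorphB; congr (_ %:C).
    rewrite !indicE !in_setI in_setC.
    by case: (x \in S); case: (x \in _) => /=; rewrite ?subrr ?subr0.
  - move=> S mS tS VS.
    have mU k : measurable (\big[setU/set0]_(i < k) S i).
      exact: bigsetU_measurable.
    apply: (cind_limit (A_ := fun k =>
      (\big[setU/set0]_(i < k) S i) `&` (F n `*` G n))).
    + by move=> k; exact: measurableI.
    + by apply: measurableI => //; exact: bigcupT_measurable.
    + by move=> k; apply: setSI; exact: bigsetU_bigcup.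
    + move=> x [[i _ Six] Qx]; exists i.+1 => // k /= ik; split => //.
      by rewrite -bigcup_mkord; exists i.
    + by apply: fIQ; exact: bigcupT_measurable.
    elim=> [|k IH].
      rewrite big_ord0 set0I (_ : cind _ = fun=> 0); first by case: V_linear.
      by apply/funext => x; rewrite /cind indic0.
    rewrite big_ord_recr /= (_ : cind _ = fun x =>
      cind ((\big[setU/set0]_(i < k) S i) `&` (F n `*` G n)) x +
      cind (S k `&` (F n `*` G n)) x).
      exact: linear_setD.
    apply/funext => x; rewrite /cind -rmorphD; congr (_ %:C).
    rewrite !indicE !in_setI in_setU.
    have [xk|_] := boolP (x \in S k); last by rewrite orbF addr0.
    rewrite (_ : x \in _ = false) ?add0r //; apply/negbTE/negP => /set_mem.
    rewrite -bigcup_mkord => -[i /= ik Six].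
    have /eqP := tS i k I I (ex_intro _ x (conj Six (set_mem xk))).
    by rewrite ltn_eqF.
apply: (cind_limit (A_ := fun n => A `&` (F n `*` G n))) => //.
  by move=> n; exact: measurableI.
- move=> [x y] Axy.
  have [i _ Fx] : (\bigcup_i F i) x by rewrite -TF.
  have [j _ Gy] : (\bigcup_i G i) y by rewrite -TG.
  exists (maxn i j) => // n /=; rewrite geq_max => /andP[ni nj]; split=> //.
  by split; [move: Fx; exact/subsetPset/ndF|move: Gy; exact/subsetPset/ndG].
- by move=> n; exact: VQ.
Qed.

End ProductDensity.

(** * Tensor products of orthonormal bases *)

Definition tensor (S1 S2 : Type) (R : realType) (f : S1 -> R[i])
  (g : S2 -> R[i]) (x : S1 * S2) : R[i] := f x.1 * g x.2.

Section Integrable.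
Context d (T : measurableType d) (R : realType).
Context (mu : {measure set T -> \bar R}).
Implicit Types f g : T -> R[i].

Definition cintegrable f : Prop :=
  mu.-integrable setT (fun x => (complex.Re (f x))%:E) /\
  mu.-integrable setT (fun x => (complex.Im (f x))%:E).

Lemma L2_cintegrable f g :
  L2 mu f -> L2 mu g -> cintegrable (fun x => f x * conjc (g x)).
Proof.
move=> /L2P[mf sf] /L2P[mg sg].
have [mr mi] := cmeasurableM mf (cmeasurable_conj mg).
have sfg : (\int[mu]_x (abs2 (f x) + abs2 (g x))%:E < +oo)%E.
  rewrite (_ : (\int[mu]_x _)%E = (L2sq mu f + L2sq mu g)%E).
    exact: lte_add_pinfty.
  rewrite /L2sq -ge0_integralD //; try exact: measurable_abs2E.
  - by move=> x _; rewrite lee_fin abs2_ge0.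
  - by move=> x _; rewrite lee_fin abs2_ge0.
have mabs : measurable_fun setT (fun x => (abs2 (f x) + abs2 (g x))%:E).
  by apply/measurable_EFinP/measurable_funD; exact: measurable_abs2.
split; apply/integrableP; split; try exact/measurable_EFinP.
- apply: le_lt_trans sfg; apply: ge0_le_integral => //.
  + by apply: measurableT_comp => //; exact/measurable_EFinP.
  + by move=> x _; rewrite lee_fin Re_mulJ_le.
- apply: le_lt_trans sfg; apply: ge0_le_integral => //.
  + by apply: measurableT_comp => //; exact/measurable_EFinP.
  + by move=> x _; rewrite lee_fin Im_mulJ_le.
Qed.

End Integrable.

Section Tensor.
Context d1 d2 (T1 : measurableType d1) (T2 : measurableType d2) (R : realType).
Context (m1 : {sigma_finite_measure set T1 -> \bar R}).
Context (m2 : {sigma_finite_measure set T2 -> \bar R}).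
Implicit Types (f : T1 -> R[i]) (g : T2 -> R[i]) (u : T1 -> R) (v : T2 -> R).

Lemma cmeasurable_tensor f g :
  cmeasurable f -> cmeasurable g -> cmeasurable (tensor f g).
Proof.
by move=> mf mg; apply: cmeasurableM;
  [exact: (cmeasurable_comp measurable_fst mf)
  |exact: (cmeasurable_comp measurable_snd mg)].
Qed.

Lemma L2sq_tensor f g : cmeasurable f -> cmeasurable g ->
  L2sq (m1 \x m2)%E (tensor f g) = (L2sq m1 f * L2sq m2 g)%E.
Proof.
move=> mf mg; rewrite /L2sq fubini_tonelli1 /=; first last.
- by move=> x; rewrite lee_fin abs2_ge0.
- by apply: measurable_abs2E; exact: cmeasurable_tensor.
rewrite -ge0_integralZr //; first last.
- exact: L2sq_ge0.
- by move=> x _; rewrite lee_fin abs2_ge0.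
- exact: measurable_abs2E.
apply: eq_integral => x _; rewrite /fubini_F -ge0_integralZl_EFin ?abs2_ge0 //.
- by apply: eq_integral => y _; rewrite /tensor abs2M.
- by move=> y _; rewrite lee_fin abs2_ge0.
- exact: measurable_abs2E.
Qed.

Lemma L2_tensor f g : L2 m1 f -> L2 m2 g -> L2 (m1 \x m2)%E (tensor f g).
Proof.
move=> /L2P[mf sf] /L2P[mg sg]; apply/L2P; split.
  exact: cmeasurable_tensor.
by rewrite L2sq_tensor // lte_mul_pinfty ?L2sq_ge0 // ge0_fin_numE ?L2sq_ge0.
Qed.

Lemma integrable_tensor u v :
  m1.-integrable setT (EFin \o u) -> m2.-integrable setT (EFin \o v) ->
  (m1 \x m2)%E.-integrable setT (fun x => (u x.1 * v x.2)%:E).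
Proof.
move=> /integrableP[/measurable_EFinP mu su].
move=> /integrableP[/measurable_EFinP mv sv].
have muv : measurable_fun setT (fun x : T1 * T2 => u x.1 * v x.2).
  by apply: measurable_funM;
    [exact: (measurableT_comp mu measurable_fst)
    |exact: (measurableT_comp mv measurable_snd)].
apply/integrable12ltyP; first exact/measurable_EFinP.
rewrite (_ : (\int[m1]_x _)%E =
  ((\int[m1]_x `|(u x)%:E|) * (\int[m2]_y `|(v y)%:E|))%E).
  by rewrite lte_mul_pinfty ?integral_ge0 // ge0_fin_numE ?integral_ge0.
rewrite -ge0_integralZr ?integral_ge0 //; last first.
  by apply: measurableT_comp => //; exact/measurable_EFinP.
apply: eq_integral => x _ /=; rewrite -ge0_integralZl_EFin //.
- by apply: eq_integral => y _; rewrite normrM.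
- by apply/measurable_EFinP; exact: measurableT_comp.
Qed.

Lemma Rintegral_tensor u v :
  m1.-integrable setT (EFin \o u) -> m2.-integrable setT (EFin \o v) ->
  \int[(m1 \x m2)%E]_x (u x.1 * v x.2) = (\int[m1]_x u x) * \int[m2]_y v y.
Proof.
move=> iu iv; rewrite /Rintegral -integral12_prod_meas1; last first.
  exact: integrable_tensor.
have fv := integrable_fin_num measurableT iv.
have fu := integrable_fin_num measurableT iu.
rewrite -fineM //; congr fine.
rewrite -(fineK fv) -integralZr //; apply: eq_integral => x _.
by rewrite fineK // /fubini_F -integralZl.
Qed.

Lemma cintegral_tensor f g : cintegrable m1 f -> cintegrable m2 g ->
  cintegral (m1 \x m2)%E (tensor f g) = cintegral m1 f * cintegral m2 g.
Proof.
move=> [fr fi] [gr gi]; rewrite /cintegral.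
under eq_Rintegral do rewrite ReM.
under [X in _ +i* X]eq_Rintegral do rewrite ImM.
rewrite RintegralB //; [|exact: (integrable_tensor fr gr)
                        |exact: (integrable_tensor fi gi)].
rewrite RintegralD //; [|exact: (integrable_tensor fr gi)
                        |exact: (integrable_tensor fi gr)].
have RR := Rintegral_tensor (u := fun x => complex.Re (f x))
  (v := fun x => complex.Re (g x)) fr gr.
have II := Rintegral_tensor (u := fun x => complex.Im (f x))
  (v := fun x => complex.Im (g x)) fi gi.
have RI := Rintegral_tensor (u := fun x => complex.Re (f x))
  (v := fun x => complex.Im (g x)) fr gi.
have IR := Rintegral_tensor (u := fun x => complex.Im (f x))
  (v := fun x => complex.Re (g x)) fi gr.
by rewrite /= in RR II RI IR; rewrite RR II RI IR.
Qed.

Lemma L2inner_tensor f f' g g' :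
  L2 m1 f -> L2 m1 f' -> L2 m2 g -> L2 m2 g' ->
  L2inner (m1 \x m2)%E (tensor f g) (tensor f' g') =
  L2inner m1 f f' * L2inner m2 g g'.
Proof.
move=> Lf Lf' Lg Lg'; rewrite /L2inner -cintegral_tensor;
  try exact: L2_cintegrable.
by congr cintegral; apply/funext => x; rewrite /tensor rmorphM /=; ring.
Qed.

Section Limits.
Context (V : set (T1 * T2 -> R[i])).
Hypothesis V_linear : linear_set V.
Hypothesis V_closed : L2closure (m1 \x m2)%E V `<=` V.

(** The norm of a tensor product is the product of the norms, so approximating
    one factor approximates the product. *)
Lemma tensor_limitr f (W : set (T2 -> R[i])) : L2 m1 f -> W `<=` L2 m2 ->
  (forall g, W g -> V (tensor f g)) ->
  forall g, L2closure m2 W g -> V (tensor f g).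
Proof.
move=> Lf WL VW g [Lg gW]; apply: V_closed; split; first exact: L2_tensor.
move=> eps e0; have /fineK fE : L2sq m1 f \is a fin_num.
  by rewrite ge0_fin_numE ?L2sq_ge0 // L2sq_lty.
have f0 : 0 <= fine (L2sq m1 f) by rewrite fine_ge0 // L2sq_ge0.
have f10 : 0 < fine (L2sq m1 f) + 1 by rewrite ltr_wpDl.
have [|h Wh gh] := gW (eps / (fine (L2sq m1 f) + 1)); first by rewrite divr_gt0.
exists (tensor f h); first exact: VW.
rewrite (_ : (fun x => _) = tensor f (fun y => g y - h y)); last first.
  by apply/funext => x; rewrite /tensor mulrBr.
have mf := L2_measurable Lf.
have mgh := cmeasurableB (L2_measurable Lg) (L2_measurable (WL _ Wh)).
rewrite L2sq_tensor // -fE.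
apply: (@le_lt_trans _ _ ((fine (L2sq m1 f) + 1)%:E *
    L2sq m2 (fun y => g y - h y)%R)%E).
  by apply: lee_pmul => //; rewrite ?lee_fin ?L2sq_ge0 ?lerDl.
by rewrite muleC -lte_pdivlMr.
Qed.

Lemma tensor_limitl g (W : set (T1 -> R[i])) : L2 m2 g -> W `<=` L2 m1 ->
  (forall f, W f -> V (tensor f g)) ->
  forall f, L2closure m1 W f -> V (tensor f g).
Proof.
move=> Lg WL VW f [Lf fW]; apply: V_closed; split; first exact: L2_tensor.
move=> eps e0; have /fineK gE : L2sq m2 g \is a fin_num.
  by rewrite ge0_fin_numE ?L2sq_ge0 // L2sq_lty.
have g0 : 0 <= fine (L2sq m2 g) by rewrite fine_ge0 // L2sq_ge0.
have g10 : 0 < fine (L2sq m2 g) + 1 by rewrite ltr_wpDl.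
have [|h Wh fh] := fW (eps / (fine (L2sq m2 g) + 1)); first by rewrite divr_gt0.
exists (tensor h g); first exact: VW.
rewrite (_ : (fun x => _) = tensor (fun y => f y - h y) g); last first.
  by apply/funext => x; rewrite /tensor mulrBl.
have mg := L2_measurable Lg.
have mfh := cmeasurableB (L2_measurable Lf) (L2_measurable (WL _ Wh)).
rewrite L2sq_tensor // -gE.
apply: (@le_lt_trans _ _ (L2sq m1 (fun y => f y - h y)%R *
    (fine (L2sq m2 g) + 1)%:E)%E).
  by apply: lee_pmul => //; rewrite ?lee_fin ?L2sq_ge0 ?lerDl.
by rewrite -lte_pdivlMr.
Qed.

End Limits.

(** The basis in the second variable may change with the basis element in the
    first: each a_i times L2(m2) is a closed subspace, these subspaces are
    mutually orthogonal, and any basis may be used in each of them. *)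
Lemma tensor_orthonormal_basis (I K : eqType) (D1 : set I) (D2 : I -> set K)
    (a : I -> T1 -> R[i]) (b : I -> K -> T2 -> R[i]) :
  orthonormal_basis m1 D1 a ->
  (forall i, D1 i -> orthonormal_basis m2 (D2 i) (b i)) ->
  orthonormal_basis (m1 \x m2)%E [set p : I * K | D1 p.1 /\ D2 p.1 p.2]
    (fun p => tensor (a p.1) (b p.1 p.2)).
Proof.
move=> /orthonormal_basisP[aL aO aT] onb_b.
have bL i k : D1 i -> D2 i k -> L2 m2 (b i k).
  by move=> Di; have [bL _ _] := onb_b i Di; exact: bL.
set D := [set p : I * K | _]; set e := fun p : I * K => _.
have eL p : D p -> L2 (m1 \x m2)%E (e p).
  by move=> [Dp1 Dp2]; apply: L2_tensor; [exact: aL | exact: bL].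
apply/orthonormal_basisP; split => //.
  move=> [i k] [i' k'] [/= Di Dk] [/= Di' Dk'].
  rewrite L2inner_tensor ?aO //; [|exact: aL|exact: aL|exact: bL|exact: bL].
  rewrite xpair_eqE; have [ii'|_] := eqVneq i i'; last by rewrite mul0r.
  by subst i'; have [_ bO _] := onb_b i Di; rewrite bO // mul1r.
have spanL : span D e `<=` L2 (m1 \x m2)%E.
  by apply: span_sub => //; exact: L2_linear_set.
have VL := L2closure_linear spanL (span_linear D e).
have VC := L2closure_idem spanL.
set V := L2closure _ _ in VL VC *.
have Vr f : linear_set [set g | V (tensor f g)].
  split=> [/=|c g h /= Vg Vh].
    rewrite (_ : tensor _ _ = fun=> 0); first by case: VL.
    by apply/funext => x; rewrite /tensor mulr0.
  rewrite (_ : tensor _ _ = fun x => c * tensor f g x + tensor f h x).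
    by case: VL => _; apply.
  by apply/funext => x; rewrite /tensor; ring.
have Vl g : linear_set [set f | V (tensor f g)].
  split=> [/=|c f h /= Vg Vh].
    rewrite (_ : tensor _ _ = fun=> 0); first by case: VL.
    by apply/funext => x; rewrite /tensor mul0r.
  rewrite (_ : tensor _ _ = fun x => c * tensor f g x + tensor h g x).
    by case: VL => _; apply.
  by apply/funext => x; rewrite /tensor; ring.
have Va i g : D1 i -> L2 m2 g -> V (tensor (a i) g).
  move=> Di Lg; have /orthonormal_basisP[_ _ bT] := onb_b i Di.
  apply: (tensor_limitr VC (aL i Di) _ _ (bT _ Lg)).
  - by apply: span_sub; [exact: L2_linear_set | move=> k; exact: bL].
  - apply: (span_sub (Vr (a i))) => k Dk /=.
    by apply: (sub_L2closure spanL); exact: (@span_mem _ _ _ _ D e (i, k)).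
have Vt f g : L2 m1 f -> L2 m2 g -> V (tensor f g).
  move=> Lf Lg; apply: (tensor_limitl VC Lg _ _ (aT _ Lf)).
  - by apply: span_sub; [exact: L2_linear_set | exact: aL].
  - by apply: (span_sub (Vl g)) => i Di; exact: Va.
apply: (rectangles_dense VL VC) => A B mA mB fA fB.
have L2_indic d (T : measurableType d) (mu : {measure set T -> \bar R})
    (E : set T) : measurable E -> (mu E < +oo)%E ->
    L2 mu (fun x => (\1_E x)%:C).
  move=> mE fE; apply/L2P; split.
    by apply: cmeasurable_real; exact: measurable_indic.
  rewrite /L2sq (eq_integral (fun x => (\1_E x)%:E)).
    by rewrite integral_indic // setIT.
  move=> x _; rewrite abs2_real indicE.
  by case: (x \in E); rewrite ?expr1n ?expr0n.
exact: (Vt _ _ (L2_indic _ _ _ _ mA fA) (L2_indic _ _ _ _ mB fB)).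
Qed.

End Tensor.

(** * Changes of variables *)

Section ChangeOfVariables.
Context d1 d2 (T1 : measurableType d1) (T2 : measurableType d2) (R : realType).
Context (m1 : {measure set T1 -> \bar R}) (m2 : {measure set T2 -> \bar R}).
Context (F : T1 -> T2) (c : R).
Hypothesis mF : measurable_fun setT F.
Hypothesis c_ge0 : 0 <= c.
Hypothesis m1F : forall A, measurable A -> m1 (F @^-1` A) = (c%:E * m2 A)%E.

Lemma ge0_integral_image (f : T2 -> \bar R) :
  measurable_fun setT f -> (forall y, 0 <= f y)%E ->
  (\int[m1]_x f (F x) = c%:E * \int[m2]_y f y)%E.
Proof.
move=> mf f0.
have := @ge0_integral_pushforward _ _ _ _ _ F mF m1 setT f measurableT mf
  (fun y _ => f0 y).
rewrite preimage_setT => <-.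
rewrite [LHS](eq_measure_integral (mscale (NngNum c_ge0) m2)) 
  ?ge0_integral_mscale //.
by move=> A mA _; exact: m1F.
Qed.

Lemma integrable_image (u : T2 -> R) : m2.-integrable setT (EFin \o u) ->
  m1.-integrable setT (fun x => (u (F x))%:E).
Proof.
move=> /integrableP[mu su]; apply/integrableP; split.
  exact: (measurableT_comp mu mF).
rewrite (ge0_integral_image (f := fun y => `|(u y)%:E|%E)) //.
  by rewrite lte_mul_pinfty.
exact: measurableT_comp.
Qed.

Lemma Rintegral_image (u : T2 -> R) : m2.-integrable setT (EFin \o u) ->
  \int[m1]_x u (F x) = c * \int[m2]_y u y.
Proof.
move=> iu; have mu := measurable_int _ iu.
have fp := integrable_pos_fin_num measurableT iu.
have fn := integrable_neg_fin_num measurableT iu.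
rewrite /Rintegral -[c]/(fine c%:E) -fineM //; last first.
  exact: integrable_fin_num iu.
congr fine; rewrite integralE [in RHS]integralE.
rewrite muleBr //; last by rewrite fin_num_adde_defr.
congr (_ - _)%E; rewrite -ge0_integral_image //.
- by rewrite (funepos_comp (EFin \o u) F).
- exact: measurable_funepos.
- by rewrite (funeneg_comp (EFin \o u) F).
- exact: measurable_funeneg.
Qed.

End ChangeOfVariables.

Section Unitary.
Context d1 d2 (T1 : measurableType d1) (T2 : measurableType d2) (R : realType).
Context (m1 : {measure set T1 -> \bar R}) (m2 : {measure set T2 -> \bar R}).
Context (F : T1 -> T2) (G : T2 -> T1) (c k : R).
Hypothesis mF : measurable_fun setT F.
Hypothesis mG : measurable_fun setT G.
Hypothesis FK : cancel F G.
Hypothesis kc : k ^+ 2 * c = 1.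
Hypothesis m1F : forall A, measurable A -> m1 (F @^-1` A) = (c%:E * m2 A)%E.

(** If F multiplies measures by c, then composition with F, rescaled by k with
    k ^ 2 * c = 1, is a unitary operator from L2(m2) onto L2(m1); it therefore
    carries orthonormal bases to orthonormal bases. *)
Lemma orthonormal_basis_image (I : eqType) (D : set I) (e : I -> T2 -> R[i]) :
  orthonormal_basis m2 D e ->
  orthonormal_basis m1 D (fun i x => k%:C * e i (F x)).
Proof.
have k2 : k ^+ 2 != 0.
  by apply: contra_eq_neq kc => ->; rewrite mul0r eq_sym oner_eq0.
have k0 : k != 0 by move: k2; rewrite sqrf_eq0.
have c_ge0 : 0 <= c.
  by rewrite -(pmulr_rge0 c (_ : 0 < k ^+ 2)) ?kc // lt_def k2 sqr_ge0.
have Usq f : cmeasurable f -> L2sq m1 (fun x => k%:C * f (F x)) = L2sq m2 f.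
  move=> mf; rewrite L2sqZ; last exact: cmeasurable_comp mf.
  rewrite /L2sq (ge0_integral_image mF c_ge0 m1F
    (f := fun y => (abs2 (f y))%:E)).
  - by rewrite muleA -EFinM abs2_real kc mul1e.
  - exact: measurable_abs2E.
  - by move=> y; rewrite lee_fin abs2_ge0.
have Um f : cmeasurable f -> cmeasurable (fun x => k%:C * f (F x)).
  move=> mf; apply: cmeasurableM; first exact: cmeasurable_cst.
  exact: cmeasurable_comp mf.
have Uint u : m2.-integrable setT (fun y => (u y)%:E) ->
    \int[m1]_x (k ^+ 2 * u (F x)) = \int[m2]_y u y.
  move=> iu; rewrite RintegralZl //; last exact: integrable_image m1F _ iu.
  by rewrite (Rintegral_image mF c_ge0 m1F) // mulrA kc mul1r.
move=> /orthonormal_basisP[eL eO eT]; apply/orthonormal_basisP; split.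
- by move=> i /eL /L2P[mi si]; apply/L2P; rewrite Usq //; split=> //; exact: Um.
- move=> i j Di Dj; rewrite -(eO i j Di Dj) /L2inner /cintegral.
  have [ir ii] := L2_cintegrable (eL i Di) (eL j Dj).
  have E x : k%:C * e i (F x) * conjc (k%:C * e j (F x)) =
             (k ^+ 2)%:C * (e i (F x) * conjc (e j (F x))).
    rewrite (_ : conjc (k%:C * e j (F x)) = k%:C * conjc (e j (F x))).
      by rewrite rmorphXn /=; ring.
    by rewrite rmorphM; congr (_ * _); exact: conjc_real.
  under eq_Rintegral do rewrite E ReM mul0r subr0.
  under [X in _ +i* X]eq_Rintegral do rewrite E ImM mul0r addr0.
  by rewrite (Uint _ ir) (Uint _ ii).
move=> f Lf; split=> // eps e0.
have [mf sf] := (L2P _ _).1 Lf.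
pose g y := k^-1%:C * f (G y).
have mg : cmeasurable g.
  apply: cmeasurableM; first exact: cmeasurable_cst.
  exact: cmeasurable_comp mf.
have fg x : f x = k%:C * g (F x).
  by rewrite /g FK mulrA -rmorphM mulfV // mul1r.
have Lg : L2 m2 g.
  apply/L2P; split=> //; rewrite -Usq //.
  by rewrite (_ : (fun x => _) = f) //; apply/funext => x; rewrite -fg.
have [_ /(_ _ e0)[_ [r [a [Dr ->]]] gr]] := eT g Lg.
exists (fun x => \sum_(i <- r) a i * (k%:C * e i (F x))); first by exists r, a.
rewrite (_ : (fun x => _) = fun x => k%:C *
    (fun y => g y - \sum_(i <- r) a i * e i y) (F x)); last first.
  apply/funext => x; rewrite fg mulrBr mulr_sumr; congr (_ - _).
  by apply: eq_bigr => i _; ring.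
rewrite (Usq (fun y => g y - \sum_(i <- r) a i * e i y)) //.
have Lsum : span D e `<=` L2 m2 by apply: span_sub => //; exact: L2_linear_set.
apply: cmeasurableB => //; apply: (L2_measurable (mu := m2)).
by apply: Lsum; exists r, a.
Qed.

End Unitary.

Lemma orthonormal_basis_reindex d (T : measurableType d) (R : realType)
    (mu : {measure set T -> \bar R}) (I J : eqType) (D : set I) (E : set J)
    (e : I -> T -> R[i]) (f : J -> T -> R[i]) (h : J -> I) (g : I -> J) :
  (forall j, E j -> [/\ D (h j), g (h j) = j & f j = e (h j)]) ->
  (forall i, D i -> E (g i) /\ h (g i) = i) ->
  orthonormal_basis mu D e -> orthonormal_basis mu E f.
Proof.
move=> hP gP [eL eO eT]; split.
- by move=> j /hP[Dj _ ->]; exact: eL.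
- move=> j j' Ej Ej'; have [Dj gj ->] := hP j Ej.
  have [Dj' gj' ->] := hP j' Ej'.
  rewrite eO //; congr (nat_of_bool _)%:R.
  by apply/eqP/eqP => [hh|->//]; rewrite -gj hh gj'.
move=> u Lu eps e0; have [r [c [Dr ur]]] := eT u Lu eps e0.
exists (map g r), (c \o h); split.
  by move=> _ /mapP[i /Dr Di ->]; have [] := gP i Di.
rewrite (_ : (fun x => _) = fun x => u x - \sum_(i <- r) c i * e i x) //.
apply/funext => x; rewrite big_map; congr (_ - _).
apply: eq_big_seq => i /Dr Di /=.
by have [/hP[_ _ ->] ->] := gP i Di.
Qed.

Section Lebesgue.
Context (R : realType).

(** Lebesgue measure is determined by its values on half-open intervals. *)
Lemma leb1_affine (a b : R) (A : set (measurableTypeR R)) :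
  0 < a -> measurable A ->
  leb1 R ((fun x => a * x + b) @^-1` A) = (a^-1%:E * leb1 R A)%E.
Proof.
move=> a0 mA.
have mF : measurable_fun setT
    (fun x : measurableTypeR R => a * x + b : measurableTypeR R).
  by apply: measurable_funD => //; exact: measurable_funM.
pose m := mscale (NngNum (ltW a0))
  (pushforward (leb1 R)
    (fun x : measurableTypeR R => a * x + b : measurableTypeR R)).
suff -> : leb1 R A = m mF A.
  by rewrite /m /mscale /= muleA -EFinM mulVf ?gt_eqF // mul1e.
apply: lebesgue_measure_unique => // _ [[x y] _ <-] /=.
rewrite /m /mscale /= /pushforward.
rewrite (_ : _ @^-1` _ = `](x - b) / a, (y - b) / a]%classic); last first.
  apply/seteqP; split=> z /=; rewrite !in_itv /= => /andP[h1 h2];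
    apply/andP; split.
  - by rewrite ltr_pdivrMr // ltrBlDr mulrC.
  - by rewrite ler_pdivlMr // lerBrDr mulrC.
  - by move: h1; rewrite ltr_pdivrMr // ltrBlDr mulrC.
  - by move: h2; rewrite ler_pdivlMr // lerBrDr mulrC.
rewrite /leb1 !lebesgue_measure_itv /= !lte_fin ltr_pM2r ?invr_gt0 // ltrD2r.
case: ifPn => _; last by rewrite mule0.
by rewrite -!EFinD -EFinM; congr EFin; field; rewrite gt_eqF.
Qed.

Definition shear (s : R) (x : R * R) : R * R := (x.1 + s * x.2, x.2).

Lemma measurable_shear s : measurable_fun setT
  (shear s : measurableTypeR R * measurableTypeR R ->
             measurableTypeR R * measurableTypeR R).
Proof.
apply: measurable_fun_pair; last exact: measurable_snd.
apply: measurable_funD; first exact: measurable_fst.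
by apply: measurable_funM => //; exact: measurable_snd.
Qed.

(** A shear translates each horizontal slice, so it preserves planar measure. *)
Lemma leb2_shear s (A : set (measurableTypeR R * measurableTypeR R)) :
  measurable A -> leb2 R (shear s @^-1` A) = leb2 R A.
Proof.
move=> mA.
have mSA : measurable (shear s @^-1` A).
  by rewrite -[X in measurable X]setTI; exact: measurable_shear.
have ind B : measurable B -> leb2 R B =
    (\int[leb1 R]_y \int[leb1 R]_x (\1_B (x, y))%:E)%E.
  move=> mB; rewrite -[in LHS](setIT B) -integral_indic //.
  rewrite /leb2 fubini_tonelli2 //.
  by apply/measurable_EFinP; exact: measurable_indic.
rewrite (ind _ mSA) (ind _ mA); apply: eq_integral => y _.
have mF : measurable_fun setT
    (fun x : measurableTypeR R => 1 * x + s * y : measurableTypeR R).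
  by apply: measurable_funD => //; exact: measurable_funM.
have := @ge0_integral_image _ _ _ _ R (leb1 R) (leb1 R) _ _ mF ler01 _
  (fun x => (\1_A (x, y))%:E).
rewrite mul1e => <-.
- by apply: eq_integral => x _; rewrite mul1r.
- by move=> B mB; rewrite leb1_affine // invr1.
- apply/measurable_EFinP; apply: measurableT_comp.
    exact: measurable_indic.
  exact: pair2_measurable.
- by move=> x; rewrite lee_fin.
Qed.

End Lebesgue.

(** * Shearlets as sheared tensor products of wavelets *)

Section Shearlets.
Context (R : realType) (phi1 psi1 : R -> R[i]).
Implicit Types (s : R) (n j : nat).

Lemma powR2_half n : 2 `^ (n%:R / 2) = Num.sqrt (2 ^+ n) :> R.
Proof. by rewrite powRrM powR12_sqrt ?powR_ge0 // powR_mulrn. Qed.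

Definition dilated_wavelet n (i : int + nat * int) (x : R) : R[i] :=
  (Num.sqrt (2 ^+ n))%:C * wavelet_system phi1 psi1 i (2 ^+ n * x).

Lemma dilated_wavelet_basis n :
  orthonormal_basis (leb1 R) setT (wavelet_system phi1 psi1) ->
  orthonormal_basis (leb1 R) setT (dilated_wavelet n).
Proof.
have p0 : 0 < 2 ^+ n :> R by rewrite exprn_gt0.
have mM (a : R) : measurable_fun setT
    (fun x : measurableTypeR R => a * x : measurableTypeR R).
  exact: measurable_funM.
apply: (@orthonormal_basis_image _ _ (measurableTypeR R) (measurableTypeR R) R
  (leb1 R) (leb1 R) (fun x => 2 ^+ n * x) (fun x => (2 ^+ n)^-1 * x)
  (2 ^+ n)^-1 _ (mM _) (mM _)).
- by move=> x; rewrite mulKf // gt_eqF.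
- by rewrite sqr_sqrtr ?(ltW p0) // mulfV // gt_eqF.
move=> A mA; rewrite -(leb1_affine 0 p0 mA); congr (leb1 R (_ @^-1` A)).
by apply/funext => x; rewrite addr0.
Qed.

(** The scale at which the second variable is resolved is determined by the
    scale of the wavelet in the first variable. *)
Definition second_scale n (i : int + nat * int) : nat :=
  match i with inl _ => n./2 | inr (j, _) => (n + j)./2 end.

Definition sheared_tensor s n (p : (int + nat * int) * (int + nat * int)) :
    R * R -> R[i] :=
  fun x => 1%:C * tensor (dilated_wavelet n p.1)
    (dilated_wavelet (second_scale n p.1) p.2) (shear s x).

Lemma sheared_tensor_basis s n :
  orthonormal_basis (leb1 R) setT (wavelet_system phi1 psi1) ->
  orthonormal_basis (leb2 R) setT (sheared_tensor s n).
Proof.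
move=> onb.
have tb := @tensor_orthonormal_basis _ _
  (measurableTypeR R) (measurableTypeR R) R
  (@lebesgue_measure R) (@lebesgue_measure R) _ _ setT (fun=> setT) _ _
  (dilated_wavelet_basis n onb)
  (fun i _ => dilated_wavelet_basis (second_scale n i) onb).
rewrite (_ : [set p | _] = setT) in tb; last by apply/seteqP; split.
have sK : cancel (shear s) (shear (- s)).
  by move=> [x y]; rewrite /shear /=; congr pair; ring.
have kc : (1 : R) ^+ 2 * 1 = 1 by rewrite expr1n mulr1.
have m1F A : measurable A -> leb2 R (shear s @^-1` A) = (1%:E * leb2 R A)%E.
  by move=> mA; rewrite mul1e leb2_shear.
exact: (orthonormal_basis_image (m1 := leb2 R) (m2 := leb2 R)
  (measurable_shear s) (measurable_shear (- s)) sK kc m1F tb).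
Qed.

Definition wavelet_index (p : nat) (m : int) : int + nat * int :=
  if p is q.+1 then inr (q, m) else inl m.

Definition index_level (i : int + nat * int) : nat :=
  if i is inr (q, _) then q.+1 else 0.

Definition index_shift (i : int + nat * int) : int :=
  match i with inl m => m | inr (_, m) => m end.

Definition to_tensor_index n (i : shearlet_index) :
    (int + nat * int) * (int + nat * int) :=
  match i with
  | inl (m, p) => (inl m.1, wavelet_index p m.2)
  | inr (j, m, p) => (inr ((j - n)%N, m.1), wavelet_index p m.2)
  end.

Definition of_tensor_index n (i : (int + nat * int) * (int + nat * int)) :
    shearlet_index :=
  match i with
  | (inl m, w) => inl ((m, index_shift w), index_level w)
  | (inr (j, m), w) => inr ((n + j)%N, (m, index_shift w), index_level w)
  end.

Lemma mxact_mx2 (a b c d : R) (x : R * R) :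
  mxact (mx2 a b c d) x = (a * x.1 + b * x.2, c * x.1 + d * x.2).
Proof. by rewrite /mxact !mxE !big_ord_recl !big_ord0 !mxE /= !addr0. Qed.

Lemma mxact_mul (M N : 'M[R]_2) x : mxact (M *m N) x = mxact M (mxact N x).
Proof.
rewrite /mxact -mulmxA; set y := N *m _.
rewrite (_ : \col_(i < 2) _ = y) //.
apply/matrixP => i k; rewrite [LHS]mxE ord1.
by case: i => [[|[|//]] ?] /=; congr (y _ _); exact: val_inj.
Qed.

Lemma det_A_mx j : \det (A_mx R j) = 2 ^+ j * 2 ^+ j./2.
Proof.
rewrite (expand_det_row _ ord0) !big_ord_recl big_ord0 /cofactor.
by rewrite !det_mx11 !mxE /= expr0; ring.
Qed.

Lemma shear_atomE (f : R * R -> R[i]) j s (m : int * int) p (x : R * R) :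
  shear_atom f j s m p x =
  (Num.sqrt (2 ^+ j) * Num.sqrt (2 ^+ j./2))%:C *
  f (2 ^+ j * (shear s x).1 - m.1%:~R,
     2 ^+ j./2 * (shear s x).2 - 2 ^- p.-1 * m.2%:~R).
Proof.
rewrite /shear_atom det_A_mx ger0_norm ?mulr_ge0 ?exprn_ge0 //.
rewrite sqrtrM ?exprn_ge0 // mxact_mul !mxact_mx2 /shear.
congr (_ * f _); apply/eqP; rewrite xpair_eqE /=.
by apply/andP; split; apply/eqP; ring.
Qed.

Lemma dilated_waveletE n p m (x : R) :
  dilated_wavelet n (wavelet_index p m) x =
  (Num.sqrt (2 ^+ n))%:C *
  (if p is q.+1 then (2 `^ (q%:R / 2))%:C *
     psi1 (2 ^+ q * (2 ^+ n * x - 2 ^- q * m%:~R))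
   else phi1 (2 ^+ n * x - 2 ^- p.-1 * m%:~R)).
Proof.
case: p => [|q]; rewrite /dilated_wavelet /=.
  by rewrite expr0 invr1 mul1r.
by rewrite mulrBr mulVKf // gt_eqF // exprn_gt0.
Qed.

(** A wavelet of relative scale j - j0, dilated by 2 ^ j0, is a wavelet of scale
    j, and second_scale turns that relative scale back into j; the grid spacing
    2 ^ -(p - 1) of D_p is absorbed by the dilation 2 ^ (p - 1) in psi^p. *)
Lemma shearlet_systemE s (hs : shear_set s) i : shearlet_indices hs i ->
  shearlet_system phi1 psi1 hs i =
  sheared_tensor s (j0 hs) (to_tensor_index (j0 hs) i).
Proof.
case: i => [[m p]|[[j m] p]] /= Di; apply/funext => x;
  rewrite /shearlet_system /phi_jsmp /psi_jsmp shear_atomE /sheared_tensor mul1r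
    /tensor dilated_waveletE.
- rewrite /= /dilated_wavelet /=.
  by case: p {Di} => [|q] /=; rewrite rmorphM; ring.
- rewrite /= subnKC // /dilated_wavelet /=.
  rewrite mulrA -exprD subnK // powR2_half.
  rewrite (_ : Num.sqrt (2 ^+ j) = Num.sqrt (2 ^+ j0 hs) *
    Num.sqrt (2 ^+ (j - j0 hs))); last first.
    by rewrite -sqrtrM ?exprn_ge0 // -exprD subnKC.
  by case: p Di => [|q] _ /=; rewrite !rmorphM; ring.
Qed.

End Shearlets.

Unset Implicit Arguments.

Theorem lemma2p2 (R : realType) (rho alpha beta : R)
    (hrho : 0 < rho < 2 / 13)
    (halpha : 6 / rho + 1 <= alpha)
    (hbeta : alpha + 1 < beta)
    (phi1 psi1 : R -> R[i])
    (phi1_L2 : L2 (@leb1 R) phi1)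
    (psi1_L2 : L2 (@leb1 R) psi1)
    (phi1_supp : compactly_supported phi1)
    (psi1_supp : compactly_supported psi1)
    (phi1_inf : 0 < inf [set normc (fourier phi1 xi) |
                          xi in [set xi : R | - (1 / 2) <= xi <= 1 / 2]])
    (psi1_decay : C1_bounded_by (fourier psi1)
        (fun xi => Num.min 1 (`|xi| `^ alpha) / (1 + `|xi|) `^ beta))
    (phi1_decay : C1_bounded_by (fourier phi1)
        (fun xi => 1 / (1 + `|xi|) `^ beta))
    (wavelet_onb : orthonormal_basis (@leb1 R) setT
                     (wavelet_system phi1 psi1))
    (s : R) (hs : shear_set s) :
  orthonormal_basis (@leb2 R) (shearlet_indices hs)
    (shearlet_system phi1 psi1 hs).
Proof.
have wK p m : index_level (wavelet_index p m) = p /\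
    index_shift (wavelet_index p m) = m.
  by case: p.
have Kw w : wavelet_index (index_level w) (index_shift w) = w.
  by case: w => [?|[? ?]].
apply: (orthonormal_basis_reindex (h := to_tensor_index (j0 hs))
  (g := of_tensor_index (j0 hs)) _ _
  (sheared_tensor_basis s (j0 hs) wavelet_onb)).
  move=> i Di; split=> //; last exact: shearlet_systemE.
  case: i Di => [[[m1 m2] p]|[[j [m1 m2]] p]] /= Di;
    have [-> ->] := wK p m2; by rewrite // subnKC.
move=> [[m1|[j m1]] w] _; split=> //=; rewrite ?Kw ?addKn //.
exact: leq_addr.
Qed.
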